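(* For positive integers $n$ and $r$ let $$S(n,r):=\sum_{k=0}^{n}\frac{r}{k+r}\binom{n}{k}\in\mathbb{Q}.$$ Then: (i) $S(n,r)$ is not an integer for any $r\in\{1,2,3,4,5,6\}$ and any integer $n\ge 2$; (ii) $S(n,r)$ is not an integer for any integers $n,r$ with $1\le n\le r-1$.
   Context: Here $\binom{n}{k}$ is the usual binomial coefficient. *)

(* Defs.v *)
From mathcomp Require Import all_boot all_order all_algebra.

Set Implicit Arguments.
Unset Strict Implicit.
Unset Printing Implicit Defensive.

Import Order.TTheory GRing.Theory Num.Theory.

Local Open Scope ring_scope.

(* Only used for r >= 1, so that no denominator vanishes. *)
Definition binom_sum (n r : nat) : rat :=
  \sum_(0 <= k < n.+1) (r%:R / (k + r)%:R) * 'C(n, k)%:R.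

(* Main.v *)
Require Import Defs.
From mathcomp Require Import all_boot all_order all_algebra cyclic zify ring.

Import GRing.Theory Num.Theory.

(** Integration by parts in [S(n, r) = r * \int_0^1 x ^ (r - 1) * (1 + x) ^ n dx] shows by
    induction on [n] that ['C(n + r, n) * S(n, r)] is an odd integer; so ['C(n + r, n)] is odd
    when [S(n, r)] is an integer.  It then suffices to find a prime dividing exactly one
    denominator of a suitable sum, and not the corresponding numerator.

    For [n < r] that prime comes from Sylvester's theorem: an odd ['C(n + r, n)] has a prime
    factor [p > n], which divides a single [k + r] with [k <= n].

    For [r <= 6], expanding [(y - 1) ^ (r - 1)] in [r * \int_1^2 (y - 1) ^ (r - 1) * y ^ n dy]
    gives a sum with terms, up to sign, [r * 'C(r - 1, j) * (2 ^ m - 1) / m], [m = n + j + 1], [j < r].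
    The smallest prime factor of [m] never divides [2 ^ m - 1], and unless [n] and [r] are both
    odd (so that ['C(n + r, n)] is even) some [m] has only prime factors greater than [r].

    Sylvester's theorem is proved by the method of Erdos.  If ['C(N, n)] is odd and all its prime
    factors are at most [n], then each of its prime powers is at most [N], so few odd primes
    force [N < n ^ 2]; the primes above [sqrt N] occur at most once, and not at all above
    [N / 3].  With the bound [4 ^ x] on primorials this contradicts the size of ['C(N, n)] for
    [N >= 64 ^ 2]; smaller [N] are covered by a chain of primes with short gaps. *)

(** * Exponential and binomial estimates *)

(** Bernoulli's inequality [(1 + b / a) ^ k >= 1 + k * b / a], cleared of denominators. *)
Lemma bernoulli_nat (a b k : nat) : a ^ k * (a + k * b) <= a * (a + b) ^ k.
Proof.
elim: k => [|k IH]; first by rewrite !expn0 mul0n addn0 mul1n muln1.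
rewrite !expnS mulnCA; apply: leq_trans (leq_mul (leqnn (a + b)) IH).
have -> : a * a ^ k * (a + k.+1 * b) = a ^ k * (a * (a + k.+1 * b)) by ring.
have -> : (a + b) * (a ^ k * (a + k * b)) = a ^ k * ((a + b) * (a + k * b)) by ring.
by rewrite leq_mul2l; apply/orP; right; nia.
Qed.

(** Bernoulli again, for [(1 - 1 / (x + 1)) ^ n]; truncated subtraction makes the bound trivial once
    [n > x]. *)
Lemma bernoulli_pred (x n : nat) : x.+1 ^ n * (x.+1 - n) <= x.+1 * x ^ n.
Proof.
elim: n => [|n IH]; first by rewrite !expn0 mul1n muln1 subn0.
rewrite !expnS mulnCA; apply: leq_trans (leq_mul (leqnn x) IH).
have -> : x.+1 * x.+1 ^ n * (x.+1 - n.+1) = x.+1 ^ n * (x.+1 * (x - n)).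
  by rewrite subSS; ring.
have -> : x * (x.+1 ^ n * (x.+1 - n)) = x.+1 ^ n * (x * (x.+1 - n)) by ring.
rewrite leq_mul2l; apply/orP; right; nia.
Qed.

Lemma expn_ratio_step (c d : nat) :
  c ^ (c + d) * (c + d).+1 ^ (c + d).+1 <= c.+1 ^ (c + d).+1 * (c + d) ^ (c + d).
Proof.
case: c => [|c].
  rewrite add0n exp1n mul1n; case: d => [|d]; first by [].
  by rewrite exp0n.
set n := c.+1 + d.
(* Here [(a + b) / a] is the quotient of [(c + 2) / (n + 1)] by [(c + 1) / n], and Bernoulli with
   exponent [n + 1] yields exactly the missing factor [n / (c + 1)]. *)
have := bernoulli_nat (n.+1 * c.+1) d n.+1.
have -> : n.+1 * c.+1 + n.+1 * d = n.+1 * n by rewrite /n; ring.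
have -> : n.+1 * c.+1 + d = n * c.+2 by rewrite /n; ring.
rewrite !expnMn => H.
have n0 : 0 < n.+1 * c.+1 * n by rewrite /n.
rewrite -(leq_pmul2l n0).
have -> : n.+1 * c.+1 * n * (c.+1 ^ n * n.+1 ^ n.+1)
  = n.+1 ^ n.+1 * c.+1 ^ n.+1 * (n.+1 * n) by rewrite (expnS c.+1); ring.
have -> : n.+1 * c.+1 * n * (c.+2 ^ n.+1 * n ^ n)
  = n.+1 * c.+1 * (n ^ n.+1 * c.+2 ^ n.+1) by rewrite (expnS n); ring.
by [].
Qed.

(* [(1 - d / n) ^ n] is nondecreasing in [n]. *)
Lemma expn_ratio_mono (d K m n : nat) :
  d <= m <= n -> m ^ m <= K * (m - d) ^ m -> n ^ n <= K * (n - d) ^ n.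
Proof.
case/andP=> dm; elim: n => [|n IH].
  by rewrite leqn0 => /eqP <-.
rewrite leq_eqVlt => /orP[/eqP <- //|]; rewrite ltnS => mn H.
have {IH H} := IH mn H.
have [c ->] : exists c, n = c + d by exists (n - d); lia.
rewrite -addSn !addnK => H.
have n0 : 0 < (c + d) ^ (c + d) by rewrite expn_gt0; lia.
rewrite -(leq_pmul2l n0) addSn.
apply: (@leq_trans (K * (c ^ (c + d) * (c + d).+1 ^ (c + d).+1))).
  by rewrite mulnA leq_mul2r H orbT.
have -> : (c + d) ^ (c + d) * (K * c.+1 ^ (c + d).+1)
  = K * (c.+1 ^ (c + d).+1 * (c + d) ^ (c + d)) by ring.
by rewrite leq_mul2l expn_ratio_step orbT.
Qed.

(** The monotone quantity [(1 - d / n) ^ n] equals [4 ^ (- d)] at [n = 2 * d]. *)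
Lemma expn_le_exp4 (d n : nat) : d.*2 <= n -> n ^ n <= 4 ^ d * (n - d) ^ n.
Proof.
move=> dn; apply: (@expn_ratio_mono d (4 ^ d) d.*2); first lia.
have -> : d.*2 - d = d by lia.
by rewrite -(expnM 2 2 d) mul2n -expnMn mul2n.
Qed.

Lemma expnS_le_exp3 (n : nat) : 5 <= n -> n.+1 ^ n.+1 <= 3 * n ^ n.+1.
Proof.
move=> n5; have -> : n ^ n.+1 = (n.+1 - 1) ^ n.+1 by rewrite subn1.
(* The starting point is 6 because [6 ^ 6 <= 3 * 5 ^ 6]. *)
by apply: (@expn_ratio_mono 1 3 6); [lia | vm_compute].
Qed.

(** That is, ['C(N, n) / N ^ n] is nondecreasing in [N]: a step multiplies ['C(N, n)] by
    [(N + 1) / (N + 1 - n)], which by Bernoulli is at least [((N + 1) / N) ^ n]. *)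
Lemma bin_expn_mono (n m N : nat) :
  0 < m -> n <= m <= N -> 'C(m, n) * N ^ n <= 'C(N, n) * m ^ n.
Proof.
move=> m0 /andP[nm]; elim: N => [|N IH]; first by rewrite leqn0 => /eqP <-.
rewrite leq_eqVlt => /orP[/eqP <- //|]; rewrite ltnS => mN.
have {}IH := IH mN.
have E : (N.+1 - n) * 'C(N.+1, n) = N.+1 * 'C(N, n).
  by rewrite -mul_bin_down.
have p1 : 0 < (N.+1 - n) by lia.
have p2 : 0 < N ^ n by rewrite expn_gt0; lia.
rewrite -(leq_pmul2l p1) -(leq_pmul2l p2).
have -> : N ^ n * ((N.+1 - n) * ('C(N.+1, n) * m ^ n))
  = N ^ n * N.+1 * ('C(N, n) * m ^ n).
  transitivity (N ^ n * ((N.+1 - n) * 'C(N.+1, n)) * m ^ n); first by ring.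
  by rewrite E; ring.
apply: leq_trans (leq_mul (leqnn _) IH).
have -> : N ^ n * ((N.+1 - n) * ('C(m, n) * N.+1 ^ n))
  = N ^ n * 'C(m, n) * (N.+1 ^ n * (N.+1 - n)) by ring.
have -> : N ^ n * N.+1 * ('C(m, n) * N ^ n)
  = N ^ n * 'C(m, n) * (N.+1 * N ^ n) by ring.
by rewrite leq_mul2l bernoulli_pred orbT.
Qed.

Lemma central_bin_lower (n : nat) : 4 ^ n <= n.*2.+1 * 'C(n.*2, n).
Proof.
elim: n => [|n IH]; first by rewrite bin0.
have E : n.+1 * 'C(n.+1.*2, n.+1) = 2 * (n.*2.+1 * 'C(n.*2, n)).
  rewrite doubleS -mul_bin_diag /=.
  have E2 : n.+1 * 'C(n.*2.+1, n) = n.*2.+1 * 'C(n.*2, n).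
    have := mul_bin_down n.*2.+1 n => /=.
    by have -> : n.*2.+1 - n = n.+1 by lia; lia.
  have -> : n.*2.+2 = 2 * n.+1 by lia.
  by rewrite -mulnA E2.
rewrite expnS; nia.
Qed.

Lemma bin_lower (N n : nat) : 0 < n -> n.*2 <= N ->
  4 ^ n * N ^ n <= n.*2.+1 * 'C(N, n) * n.*2 ^ n.
Proof.
move=> n0 nN; have H := @bin_expn_mono n n.*2 N _ _.
apply: (@leq_trans (n.*2.+1 * 'C(n.*2, n) * N ^ n)).
  by rewrite leq_mul2r central_bin_lower orbT.
by rewrite -!mulnA leq_mul2l H ?orbT //; lia.
Qed.

Lemma bin_odd_le_exp4 (k : nat) : 'C(k.*2.+1, k) <= 4 ^ k.
Proof.
elim: k => [|k IH]; first by rewrite bin0.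
have E : k.+2 * 'C(k.+1.*2.+1, k.+1) = 2 * (k.*2.+3 * 'C(k.*2.+1, k)).
  rewrite doubleS.
  have E1 : k.+1 * 'C(k.*2.+3, k.+1) = k.*2.+3 * 'C(k.*2.+2, k).
    by rewrite -mul_bin_diag.
  have E2 : k.+2 * 'C(k.*2.+2, k) = k.*2.+2 * 'C(k.*2.+1, k).
    have := mul_bin_down k.*2.+2 k => /=.
    by have -> : k.*2.+2 - k = k.+2 by lia; lia.
  have p : 0 < k.+1 by [].
  apply/eqP; rewrite -(eqn_pmul2l p); apply/eqP.
  rewrite mulnCA E1 mulnCA E2 -muln2; ring.
rewrite expnS; nia.
Qed.

(** * Prime factors of binomial coefficients *)

(* Kummer: the valuation counts the carries in the base [p] addition of [n] and [m]. *)
Lemma logn_bin (p n m : nat) : prime p ->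
  logn p 'C(n + m, n) =
  \sum_(1 <= k < (n + m).+1) (p ^ k <= n %% p ^ k + m %% p ^ k).
Proof.
move=> pp; have H := bin_fact (leq_addr m n).
have /(congr1 (logn p)) := H.
rewrite lognM ?bin_gt0 ?leq_addr ?muln_gt0 ?fact_gt0 //.
rewrite lognM ?fact_gt0 // addKn !logn_fact //.
have ext x : x <= n + m ->
  \sum_(1 <= k < x.+1) x %/ p ^ k = \sum_(1 <= k < (n + m).+1) x %/ p ^ k.
  move=> xN; rewrite [RHS](@big_cat_nat _ _ _ x.+1) //=.
  rewrite [X in _ = _ + X]big1_seq ?addn0 // => k /=; rewrite mem_index_iota => /andP[xk _].
  by rewrite divn_small // (leq_trans xk) // ltnW // ltn_expl // prime_gt1.
rewrite (ext n) ?leq_addr // (ext m) ?leq_addl // => E.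
apply: (@addIn (\sum_(1 <= k < (n + m).+1) n %/ p ^ k + \sum_(1 <= k < (n + m).+1) m %/ p ^ k)).
rewrite E -!big_split /=; apply: eq_bigr => k _.
by rewrite divnD ?expn_gt0 ?prime_gt0 // addnC.
Qed.

(** No carry occurs at a position [k] with [p ^ k > n + m], so there are at most
    [trunc_log p (n + m)] carries. *)
Lemma pfactor_bin_le (p n m : nat) :
  prime p -> 0 < n + m -> p ^ logn p 'C(n + m, n) <= n + m.
Proof.
move=> pp N0; have p1 := prime_gt1 pp.
apply: leq_trans (trunc_logP p1 N0); rewrite leq_exp2l // logn_bin //.
have tN : trunc_log p (n + m) <= n + m.
  by rewrite (leq_trans (ltnW (ltn_expl _ p1))) // trunc_logP.
rewrite (@big_cat_nat _ _ _ (trunc_log p (n + m)).+1) //=.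
rewrite [X in _ + X]big1_seq ?addn0 => [|k /=].
  rewrite -[leqRHS]muln1 -[X in _ <= X * _](subn1 (trunc_log p (n + m)).+1).
  by rewrite -sum_nat_const_nat leq_sum // => k _; exact: leq_b1.
rewrite mem_index_iota => /andP[tk _]; apply/eqP; rewrite eqb0 -ltnNge.
apply: leq_ltn_trans (leq_add (leq_mod _ _) (leq_mod _ _)) _.
by rewrite (leq_trans (trunc_log_ltn _ p1)) // leq_exp2l.
Qed.

(** Modulo [p] the residues are [n - p] and [m - p], whose sum is less than [p]; higher powers of
    [p] exceed [n + m]. Hence there is no carry. *)
Lemma logn_bin_eq0 (p n m : nat) :
  prime p -> p <= n < p.*2 -> p <= m < p.*2 -> n + m < 3 * p -> n + m < p ^ 2 ->
  logn p 'C(n + m, n) = 0.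
Proof.
move=> pp /andP[pn np] /andP[pm mp] N3 N2.
rewrite logn_bin // big1_seq // => k /=; rewrite mem_index_iota => /andP[k0 _].
apply/eqP; rewrite eqb0 -ltnNge.
case: k k0 => [//|[_|k _]].
  rewrite expn1 -(subnK pn) -(subnK pm) !modnDr !modn_small; lia.
apply: leq_ltn_trans (leq_add (leq_mod _ _) (leq_mod _ _)) _.
by rewrite (leq_trans N2) // leq_exp2l // prime_gt1.
Qed.

Lemma prod_primes_in (M a b : nat) (P : pred nat) : 0 < M ->
  (forall p, a <= p < b -> P p -> prime p && (p %| M)) ->
  \prod_(a <= p < b | P p) p <= M.
Proof.
move=> M0 H; pose pi : nat_pred := [pred p | (a <= p < b) && P p].
apply: (@leq_trans M`_pi); last first.
  by rewrite dvdn_leq // dvdn_part.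
rewrite (@widen_partn (maxn M b)) ?leq_maxl //.
rewrite (big_nat_widenl a 0) // (big_nat_widen 0 b (maxn M b).+1); last lia.
apply: (@leq_trans (\prod_(0 <= p < (maxn M b).+1 | (a <= p < b) && P p) p)).
  by rewrite leq_eqVlt; apply/orP; left; apply/eqP; apply: eq_bigl => p; lia.
apply: leq_prod => p /andP[pab Pp]; have /andP[pp pM] := H p pab Pp.
rewrite -[leqLHS]expn1 leq_exp2l ?prime_gt1 // logn_gt0 mem_primes pp M0 //.
Qed.

Lemma prime_dvd_fact (p n : nat) : prime p -> (p %| n`!) = (p <= n).
Proof.
move=> pp; apply/idP/idP => [|pn]; last by rewrite dvdn_fact // prime_gt0.
elim: n => [|n IH]; first by rewrite dvdn1 => /eqP p1; rewrite p1 in pp.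
rewrite factS Euclid_dvdM // => /orP[|/IH]; first exact: dvdn_leq.
exact: leqW.
Qed.

(** Strong induction: for [x = 2 * k + 1], the primes in [[k + 2, x]] all divide
    ['C(x, k) <= 4 ^ k]; an even [x > 2] contributes no prime. *)
Lemma primorial_le (x : nat) : \prod_(0 <= p < x.+1 | prime p) p <= 4 ^ x.
Proof.
elim/ltn_ind: x => x IH.
case: (leqP x 2) => [|x2].
  by case: x {IH} => [|[|[|//]]] _; rewrite unlock.
case: (boolP (odd x)) => ox; last first.
  have npx : ~~ prime x by apply: contraNN ox => /even_prime; lia.
  rewrite big_mkcond big_nat_recr //= (negPf npx) muln1 -big_mkcond /=.
  have -> : x = x.-1.+1 by lia.
  apply: leq_trans (IH x.-1 _) _; first lia.
  by rewrite leq_exp2l.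
have [k xk] : exists k, x = k.*2.+1 by exists x./2; lia.
rewrite (@big_cat_nat _ _ _ k.+2) //=; last lia.
have -> : 4 ^ x = 4 ^ k.+1 * 4 ^ k by rewrite -expnD; congr expn; lia.
apply: leq_mul; first by apply: IH; lia.
apply: leq_trans (bin_odd_le_exp4 k).
apply: prod_primes_in => [|p pk pp]; first by rewrite bin_gt0; lia.
rewrite pp /=.
have H : p %| 'C(k.*2.+1, k) * (k`! * (k.*2.+1 - k)`!).
  rewrite bin_fact; last lia.
  by rewrite prime_dvd_fact //; lia.
move: H; rewrite !Euclid_dvdM // => /orP[//|/orP[]]; rewrite prime_dvd_fact //; lia.
Qed.

Definition odd_primes (x : nat) : nat := \sum_(0 <= p < x.+1 | prime p && odd p) 1.

Lemma odd_primesS x : odd_primes x.+1 = odd_primes x + (prime x.+1 && odd x.+1).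
Proof.
rewrite /odd_primes big_mkcond big_nat_recr //= -big_mkcond /=.
by case: (prime _ && _).
Qed.

Lemma odd_primes_half (x : nat) : 0 < x -> (odd_primes x).*2 <= x - 1.
Proof.
suff H y : (odd_primes y.*2.+1).*2 <= y.*2 /\ (odd_primes y.*2.+2).*2 <= y.*2.
  move=> x0; have := H x.-1./2; case: (boolP (odd x)) => ox.
    have -> : x.-1./2.*2.+1 = x by lia.
    lia.
  have -> : x.-1./2.*2.+2 = x by lia.
  lia.
elim: y => [|y [_ IH]]; first by rewrite /odd_primes unlock.
rewrite doubleS (odd_primesS y.*2.+3) (odd_primesS y.*2.+2).
have -> : odd y.*2.+4 = false by lia.
rewrite andbF addn0; lia.
Qed.

(** Six consecutive integers above 3 contain three odd numbers, one of them a multiple of 3, hence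
    at most two primes. *)
Lemma odd_primes_third (x : nat) : 3 * odd_primes x <= x + 2.
Proof.
elim/ltn_ind: x => x IH.
case: (leqP x 8) => [|x8].
  by move: x {IH}; do 9 (case; first by rewrite /odd_primes unlock); case.
have [y xy] : exists y, x = y + 6 by exists (x - 6); lia.
have {}IH := IH y ltac:(lia).
have E : odd_primes x <= odd_primes y + 2.
  have nd p : 3 < p -> p %% 3 = 0 -> prime p = false.
    move=> p3 /eqP d; apply/negP => /primeP[_ /(_ 3 d)]; lia.
  rewrite xy !addnS addn0 !odd_primesS.
  have H3 z : 2 < z ->
    (prime z.+1 && odd z.+1) + (prime z.+3 && odd z.+3)
      + (prime z.+1.+4 && odd z.+1.+4) <= 2.
    move=> z3.
    have [h|[h|h]] : z.+1 %% 3 = 0 \/ z.+3 %% 3 = 0 \/ z.+1.+4 %% 3 = 0 by lia.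
    - rewrite (nd z.+1) //; lia.
    - rewrite (nd z.+3) //; lia.
    - rewrite (nd z.+1.+4) //; lia.
  have := H3 y ltac:(lia); have := H3 y.+1 ltac:(lia).
  case: (boolP (odd y)) => oy /=; rewrite ?andbT ?andbF /= ?oy ?andbT ?andbF; lia.
lia.
Qed.

(** * Sylvester's theorem for odd binomial coefficients *)

(** The multiple [x] of [p] is a factor of [(r + n) ^_ n], which is ['C(n + r, n) * n!], and [p > n]
    does not divide the factorial. *)
Lemma dvdn_bin_window (p x n r : nat) :
  prime p -> n < p -> p %| x -> r < x <= r + n -> p %| 'C(n + r, n).
Proof.
move=> pp np px /andP[rx xn].
have H : x %| (r + n) ^_ n.
  elim: n xn {np} => [|n IH]; first by lia.
  rewrite addnS leq_eqVlt ltnS ffactSS => /orP[/eqP ->|/IH h]; first exact: dvdn_mulr.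
  exact: dvdn_mull.
have := dvdn_trans px H; rewrite addnC -bin_ffact Euclid_dvdM // prime_dvd_fact //.
by rewrite leqNgt np orbF.
Qed.

Lemma path_bracket (e : rel nat) (p : nat) (s : seq nat) (x : nat) :
  path e p s -> p <= x < last p s -> exists a b, [/\ e a b, a <= x & x < b].
Proof.
elim: s p => [|q s IH] p /=; first by move=> _; lia.
case/andP=> epq eqs /andP[px xl]; case: (ltnP x q) => [xq|qx].
  by exists p, q.
by apply: (IH q) => //; rewrite qx.
Qed.

(** A selection of primes, ending just above 4096, where the general estimates take over. *)
Definition prime_chain : seq nat := [::
  5; 7; 11; 13; 17; 19; 23; 29; 31; 37; 41; 47; 53; 59; 67; 71; 79; 89; 97; 103; 113; 127;
  137; 149; 157; 167; 179; 191; 197; 211; 223; 239; 251; 263; 277; 293; 307; 313; 331; 347; 367;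
  383; 401; 419; 439; 457; 479; 499; 521; 541; 563; 587; 607; 631; 653; 677; 701; 719; 743; 769;
  797; 823; 853; 877; 907; 919; 947; 977; 1009; 1031; 1063; 1097; 1129; 1163; 1193; 1223; 1259;
  1291; 1327; 1361; 1373; 1409; 1447; 1481; 1511; 1543; 1579; 1619; 1657; 1699; 1741; 1783; 1823;
  1867; 1907; 1949; 1993; 2039; 2083; 2129; 2161; 2203; 2239; 2287; 2333; 2377; 2423; 2473; 2521;
  2557; 2609; 2647; 2699; 2749; 2797; 2851; 2903; 2957; 3011; 3061; 3109; 3163; 3203; 3251; 3301;
  3359; 3413; 3467; 3527; 3583; 3643; 3701; 3761; 3821; 3877; 3929; 3989; 4049; 4099].

(* A window of [n] integers strictly between [a] and [b] has [n <= b - a - 1]; if moreover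
   [n + r < n ^ 2] then [a < n * (n - 1)], which the second condition forbids.  The pair
   [(113, 127)] is treated apart. *)
Definition chain_step (a b : nat) : bool :=
  prime b && ((b - a - 1) * (b - a - 2) <= a) || (a == 113) && (b == 127).

Lemma prime_chain_path : path chain_step 2 prime_chain.
Proof. by vm_compute. Qed.

Lemma sylvester_small (n r : nat) : n < r -> r < 4096 -> n + r < n ^ 2 ->
  exists p, [/\ prime p, n < p & p %| 'C(n + r, n)].
Proof.
move=> nr r4 Nn.
have [|a [b [ab ar rb]]] := @path_bracket _ _ _ r prime_chain_path.
  have -> : last 2 prime_chain = 4099 by vm_compute.
  by case: n nr Nn => [|[|n]]; lia.
have pb : prime b by case/orP: ab => /andP[] // _ /eqP ->.
(* Either the prime [b] lies in the window [(r, r + n]], or the whole window lies strictly between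
   [a] and [b]. *)
case: (leqP b (r + n)) => brn.
  exists b; split=> //; first lia.
  by apply: (@dvdn_bin_window b b); rewrite ?rb //; lia.
have n2 : a < n * (n - 1) by nia.
case/orP: ab => /andP[].
  move=> _ H; have : n * (n - 1) <= (b - a - 1) * (b - a - 2) by apply: leq_mul; lia.
  lia.
move=> /eqP ea /eqP eb; rewrite {}ea {}eb in ar rb brn n2.
have n12 : 12 <= n by nia.
(* With [n >= 12] and [113 <= r < r + n < 127], the window contains [118 = 2 * 59]. *)
exists 59; split=> //; first lia.
by apply: (@dvdn_bin_window 59 118) => //; lia.
Qed.

Lemma prod_odd_primes_const (N x : nat) :
  \prod_(0 <= p < x.+1 | prime p && odd p) N = N ^ odd_primes x.
Proof. by rewrite expn_sum; apply: eq_bigr => p _; rewrite expn1. Qed.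

Lemma prod_pfactor_odd (C n : nat) : odd C -> (forall p, prime p -> p %| C -> p <= n) ->
  C = \prod_(0 <= p < n.+1 | prime p && odd p) p ^ logn p C.
Proof.
move=> oC small; have C0 : 0 < C by case: C oC {small}.
rewrite -{1}[C](partnT C0) (@widen_partn (maxn C n)) ?leq_maxl //.
rewrite [RHS](@big_nat_widen _ _ _ _ n.+1 (maxn C n).+1); last lia.
rewrite [LHS]big_mkcond [RHS]big_mkcond /=; apply: eq_bigr => p _.
case: ifP => // /negbT H; rewrite lognE.
case: (boolP [&& _, _ & _]) => // /and3P[pp _ pC].
move: H; rewrite pp ltnS (small p pp pC) andbT /=.
by rewrite (dvdn_odd pC).
Qed.

Lemma bin_le_expn_odd_primes (n r : nat) : 0 < n -> odd 'C(n + r, n) ->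
  (forall p, prime p -> p %| 'C(n + r, n) -> p <= n) ->
  'C(n + r, n) <= (n + r) ^ odd_primes n.
Proof.
move=> n0 oC small; rewrite {1}(prod_pfactor_odd _ _ oC small) -prod_odd_primes_const.
by apply: leq_prod => p /andP[pp _]; apply: pfactor_bin_le; lia.
Qed.

(** With [N = n + r] and [s] odd primes up to [n], [(N / n) ^ n <= 'C(N, n) <= N ^ s] and
    [2 * s < n]; squaring is contradictory if [n ^ 2 <= N]. *)
Lemma smooth_lt_square (n r : nat) : 0 < n < r -> odd 'C(n + r, n) ->
  (forall p, prime p -> p %| 'C(n + r, n) -> p <= n) -> n + r < n ^ 2.
Proof.
move=> /andP[n0 nr] oC small; rewrite ltnNge; apply/negP => nN.
have U := bin_le_expn_odd_primes n r n0 oC small.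
set N := n + r in nN U.
have H : N ^ n <= N ^ odd_primes n * n ^ n.
  have := @bin_expn_mono n n N n0 _; rewrite leqnn binn mul1n => H.
  apply: leq_trans (H _) _; first by rewrite /N; lia.
  by rewrite leq_mul2r U orbT.
have N1 : 1 < N by rewrite /N; lia.
have s2 := odd_primes_half n n0.
have : (N ^ n) ^ 2 <= N ^ (n - 1) * N ^ n.
  apply: (@leq_trans ((N ^ odd_primes n * n ^ n) ^ 2)); first by rewrite leq_exp2r.
  rewrite expnMn -!expnM [n * 2]mulnC [n ^ (2 * n)]expnM.
  apply: leq_mul; first by rewrite leq_exp2l //; lia.
  by rewrite leq_exp2r.
rewrite -expnM -expnD leq_exp2l //; lia.
Qed.

Lemma bin_smooth_upper (n r m : nat) : 0 < n < r -> odd 'C(n + r, n) ->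
  (forall p, prime p -> p %| 'C(n + r, n) -> p <= n) ->
  m ^ 2 <= n + r < m.+1 ^ 2 ->
  'C(n + r, n) <= 4 ^ minn n ((n + r) %/ 3) * (n + r) ^ odd_primes m.
Proof.
move=> /andP[n0 nr] oC small /andP[mN Nm].
have Nn : n + r < n ^ 2 by apply: smooth_lt_square; rewrite ?n0.
have mn : m < n by rewrite -(ltn_exp2r _ _ (e := 2)) //; lia.
set M := minn _ _; set N := n + r in mN Nm Nn *.
have MN : M <= n by rewrite /M; lia.
rewrite {1}(prod_pfactor_odd _ _ oC small).
(* Termwise bound: primes up to [m], the integer square root of [N], pay [N]; larger ones occur at
   most once and pay [p], or nothing above [M]. *)
apply: (@leq_trans (\prod_(0 <= p < n.+1 | prime p && odd p)
   ((if p <= M then p else 1) * (if p <= m then N else 1)))).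
  apply: leq_prod => p /andP[pp _]; have p0 := prime_gt0 pp.
  case: (leqP p m) => pm.
    have H : p ^ logn p 'C(N, n) <= N by apply: pfactor_bin_le; rewrite -/N //; lia.
    case: ifP => _; last by rewrite mul1n.
    by apply: leq_trans H _; rewrite leq_pmull.
  have N2 : N < p ^ 2 by apply: leq_trans Nm _; rewrite leq_exp2r.
  rewrite muln1; case: (leqP p M) => pM.
    rewrite -[leqRHS]expn1 leq_exp2l ?prime_gt1 // -ltnS -(@ltn_exp2l p) ?prime_gt1 //.
    by apply: leq_ltn_trans N2; apply: pfactor_bin_le => //; lia.
  case: (boolP (p %| 'C(N, n))) => [pC|npC]; last first.
    by rewrite lognE (negPf npC) !andbF.
  (* As [p <= n < r] and [N < 3 * p], both [n] and [r] lie in [[p, 2 * p)], so there is no carry. *)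
  have pn := small p pp pC; have N3 : N < 3 * p by rewrite /M /N in pM *; lia.
  by rewrite logn_bin_eq0 // /N in N3 *; lia.
rewrite big_split /=; apply: leq_mul.
  apply: leq_trans (primorial_le M).
  rewrite (@big_nat_widen _ _ _ _ M.+1 n.+1) //.
  rewrite [leqLHS]big_mkcond [leqRHS]big_mkcond; apply: leq_prod => p _.
  rewrite ltnS; case: (boolP (prime p)) => //= pp; have := prime_gt0 pp.
  by case: (odd p); case: (p <= M).
rewrite -prod_odd_primes_const (@big_nat_widen _ _ _ _ m.+1 n.+1); last lia.
rewrite [leqLHS]big_mkcond [leqRHS]big_mkcond; apply: leq_prod => p _.
by rewrite ltnS; case: (_ && _); case: (p <= m).
Qed.

Lemma exp3_gt (m : nat) : 64 <= m -> 2 ^ m * m.+1 ^ 5 < 3 ^ m.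
Proof.
elim: m => [//|m IH]; rewrite leq_eqVlt => /orP[/eqP <-|]; first lia.
rewrite ltnS => m64; have {}IH := IH m64.
have H : 2 * m.+2 ^ 5 <= 3 * m.+1 ^ 5.
  rewrite -(addn1 m.+1); move: (m.+1) (leqW m64) => x x64.
  rewrite !expnS expn0 !muln1; nia.
rewrite (expnS 3); apply: leq_ltn_trans (_ : 3 * (2 ^ m * m.+1 ^ 5) < _).
  by rewrite expnS mulnAC mulnA -mulnA [leqRHS]mulnCA; nia.
by rewrite ltn_pmul2l.
Qed.

(** The factor [m.+1 ^ (2 + 2 * s)] will dominate [n.*2.+1 * N ^ s] for [N < m.+1 ^ 2]. After taking
    sixth powers its exponent is at most [5 * m], and the [m]-th power of [exp3_gt] applies. *)
Lemma sylvester_estimate_small (n m s : nat) : 64 <= m -> m ^ 2 <= 6 * n -> 3 * s <= m + 2 ->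
  2 ^ n * m.+1 ^ (2 + 2 * s) < 3 ^ n.
Proof.
move=> m64 mn sm; rewrite -(@ltn_exp2r _ _ 6) // expnMn -!expnM.
apply: (@leq_ltn_trans (2 ^ (n * 6) * m.+1 ^ (5 * m))).
  by rewrite leq_mul2l leq_exp2l //; lia.
have -> : n * 6 = m * m + (n * 6 - m * m) by nia.
set e := n * 6 - m * m.
rewrite (expnD 2) (expnD 3) mulnAC; apply: (@leq_trans (3 ^ (m * m) * 2 ^ e)); last first.
  by rewrite leq_mul2l; apply/orP; right; case: (e) => // k; rewrite leq_exp2r.
rewrite ltn_pmul2r ?expn_gt0 // (expnM 2) (expnM 3) (expnM m.+1) -expnMn.
rewrite ltn_exp2r //; [exact: exp3_gt | lia].
Qed.

(** Equality holds at [n = m]; a step in [n] multiplies the left side by at most [6 * n] and the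
    right side by [m ^ 2]. *)
Lemma expn_self_le_sqr (n m : nat) : 5 <= m <= n -> 6 * n <= m ^ 2 ->
  n ^ n * 2 ^ n * m ^ m <= 2 ^ m * m ^ (2 * n).
Proof.
case/andP=> m5; elim: n => [|n IH]; first by lia.
rewrite leq_eqVlt => /orP[/eqP <- _|].
  by rewrite mul2n -addnn expnD; apply/eq_leq; ring.
rewrite ltnS => mn n6; have {}IH := IH mn ltac:(lia).
have H := expnS_le_exp3 n ltac:(lia).
rewrite mulnS expnD.
have -> : 2 ^ m * (m ^ 2 * m ^ (2 * n)) = 2 ^ m * m ^ (2 * n) * m ^ 2 by ring.
apply: leq_trans (leq_mul IH n6).
apply: (@leq_trans (3 * n ^ n.+1 * 2 ^ n.+1 * m ^ m)).
  by rewrite !leq_mul.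
apply: (@leq_trans (n ^ n * 2 ^ n * m ^ m * (6 * n))).
  by rewrite !expnS; apply/eq_leq; ring.
by rewrite leq_mul2l; apply/orP; right; lia.
Qed.

Lemma sylvester_estimate_large (n m s : nat) : 64 <= m <= n -> 6 * n <= m ^ 2 -> 3 * s <= m + 2 ->
  (n.*2) ^ n * m.+1 ^ (2 + 2 * s) < m ^ (2 * n).
Proof.
case/andP=> m64 mn n6 sm; rewrite ltnNge; apply/negP => H.
have A := expn_self_le_sqr n m ltac:(lia) n6.
have {A H} : m ^ m <= 2 ^ m * m.+1 ^ (2 + 2 * s).
  have p : 0 < n ^ n * 2 ^ n by rewrite muln_gt0 !expn_gt0; lia.
  rewrite -(leq_pmul2l p); apply: leq_trans A _.
  rewrite [leqRHS]mulnCA leq_mul2l; apply/orP; right.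
  by move: H; rewrite -mul2n expnMn [2 ^ n * _]mulnC.
(* Cubing removes the third in the bound on [s]: [3 * (2 + 2 * s) <= 2 * m.+1 + 8]. *)
rewrite -(@leq_exp2r _ _ 3) // expnMn -!expnM => H.
have {}H : m ^ (m * 3) <= 2 ^ (m * 3) * (m.+1 ^ (2 * m.+1) * m.+1 ^ 8).
  apply: leq_trans H _; rewrite -expnD leq_mul2l leq_exp2l //; lia.
have B : m.+1 ^ (2 * m.+1) <= 9 * m ^ 2 * m ^ (2 * m).
  have := expnS_le_exp3 m ltac:(lia).
  rewrite -(@leq_exp2r _ _ 2) // expnMn -!expnM mulnC => B.
  apply: leq_trans B _; rewrite -mulnA -expnD; apply/eq_leq.
  by congr (_ * m ^ _); lia.
have {H}H : m ^ m <= 8 ^ m * (9 * m ^ 2 * m.+1 ^ 8).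
  have p : 0 < m ^ (2 * m) by rewrite expn_gt0; lia.
  rewrite -(leq_pmul2l p) -expnD.
  have -> : 2 * m + m = m * 3 by lia.
  apply: leq_trans H _; have -> : 2 ^ (m * 3) = 8 ^ m by rewrite mulnC expnM.
  rewrite [leqRHS]mulnCA leq_mul2l; apply/orP; right.
  have -> : m ^ (2 * m) * (9 * m ^ 2 * m.+1 ^ 8) = 9 * m ^ 2 * m ^ (2 * m) * m.+1 ^ 8 by ring.
  by rewrite leq_mul2r B orbT.
(* Here [m >= 64] is used as [8 ^ m * 8 ^ m <= m ^ m]. *)
have {}H : 8 ^ m <= 9 * m.+1 ^ 10.
  have p : 0 < 8 ^ m by rewrite expn_gt0.
  rewrite -(leq_pmul2l p) -expnMn.
  apply: (@leq_trans (m ^ m)); first by rewrite leq_exp2r //; lia.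
  apply: leq_trans H _; rewrite leq_mul2l; apply/orP; right.
  rewrite -mulnA leq_mul2l /= (expnD _ 2 8) leq_mul2r leq_exp2r //; lia.
have E := exp3_gt m m64.
(* Together with [H] this gives [9 ^ m <= 4 ^ m * m.+1 ^ 10], contrary to the square of
   [exp3_gt]. *)
have : 9 ^ m * 9 <= 4 ^ m * 8 ^ m.
  rewrite -expnMn; apply: (@leq_trans (27 ^ m)); last by rewrite leq_exp2r //; lia.
  rewrite (expnMn 9 3) leq_mul2l (@leq_exp2l 3 2 m) ?orbT //; lia.
apply/negP; rewrite -ltnNge; apply: (@leq_ltn_trans (4 ^ m * (9 * m.+1 ^ 10))).
  by rewrite leq_mul2l H orbT.
have : (2 ^ m * m.+1 ^ 5) ^ 2 < (3 ^ m) ^ 2 by rewrite ltn_exp2r.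
have -> : (3 ^ m) ^ 2 = 9 ^ m by rewrite -expnM mulnC expnM.
have -> : (2 ^ m * m.+1 ^ 5) ^ 2 = 4 ^ m * m.+1 ^ 10.
  by rewrite expnMn -!expnM mulnC [m * 2]mulnC [2 ^ _]expnM mulnC.
move: (4 ^ m) (9 ^ m) (m.+1 ^ 10) => x y z; lia.
Qed.

Lemma isqrt_exists (N : nat) : exists m, m ^ 2 <= N < m.+1 ^ 2.
Proof.
elim: N => [|N [m /andP[H1 H2]]]; first by exists 0.
case: (ltnP N.+1 (m.+1 ^ 2)) => H; first by exists m; rewrite H andbT ltnW.
by exists m.+1; rewrite H /= (leq_ltn_trans H2) // ltn_exp2r.
Qed.

Lemma sylvester_odd_bin (n r : nat) : 0 < n < r -> odd 'C(n + r, n) ->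
  exists p, [/\ prime p, n < p & p %| 'C(n + r, n)].
Proof.
move=> nr oC.
case: (boolP (has (fun p => (n < p)) (primes 'C(n + r, n)))) => [/hasP[p]|/hasPn H].
  by rewrite mem_primes => /and3P[pp _ pC] np; exists p.
have C0 : 0 < 'C(n + r, n) by rewrite bin_gt0 leq_addr.
have small p : prime p -> p %| 'C(n + r, n) -> p <= n.
  by move=> pp pC; rewrite leqNgt H // mem_primes pp C0.
have Nn := smooth_lt_square n r nr oC small.
case: (ltnP r 4096) => r4; first by apply: sylvester_small; lia.
have [m /andP[mN Nm]] := isqrt_exists (n + r).
have U := bin_smooth_upper n r m nr oC small ltac:(lia).
have s3 := odd_primes_third m; set s := odd_primes m in U s3.
have m64 : 64 <= m.
  by rewrite -ltnS -(ltn_exp2r _ _ (e := 2)) //; apply: leq_ltn_trans Nm; lia.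
have mn : m <= n by rewrite ltnW // -(ltn_exp2r _ _ (e := 2)) //; lia.
have [n0 rn] := andP nr.
have L := bin_lower (n + r) n n0 ltac:(lia).
set N := n + r in U L mN Nm Nn *; set M := minn n _ in U.
have {U}L : 4 ^ n * N ^ n <= 4 ^ M * (m.+1 ^ (2 + 2 * s) * n.*2 ^ n).
  apply: leq_trans L _; rewrite [leqRHS]mulnA leq_mul2r; apply/orP; right.
  apply: leq_trans (leq_mul (leqnn _) U) _.
  rewrite mulnCA leq_mul2l; apply/orP; right.
  rewrite expnD expnM; apply: leq_mul; first by rewrite /N in Nm *; lia.
  case: (posnP s) => [->|s0]; first by rewrite !expn0.
  by rewrite leq_exp2r // ltnW.
have n2p : 0 < n ^ n by rewrite expn_gt0 n0.
(* If [3 * n <= N], then [M = n] and the powers of 4 cancel; [N] is bounded below by [3 * n] or by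
   [m ^ 2], whichever estimate fits. *)
case: (leqP (3 * n) N) => N3.
  have EM : M = n by rewrite /M; lia.
  rewrite EM leq_pmul2l ?expn_gt0 // in L.
  case: (leqP (m ^ 2) (6 * n)) => mn6.
    have := sylvester_estimate_small n m s m64 mn6 s3; rewrite ltnNge => /negP[].
    rewrite -(leq_pmul2r n2p) -expnMn.
    apply: (@leq_trans (N ^ n)); first by rewrite leq_exp2r.
    by apply: leq_trans L _; rewrite -mul2n expnMn; apply/eq_leq; ring.
  have := sylvester_estimate_large n m s ltac:(lia) ltac:(lia) s3; rewrite ltnNge => /negP[].
  rewrite [leqRHS]mulnC; apply: leq_trans L.
  by rewrite expnM leq_exp2r.
have EM : M = N %/ 3 by rewrite /M; lia.
have := sylvester_estimate_small n m s m64 ltac:(lia) s3; rewrite ltnNge => /negP[].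
(* Now [M = N %/ 3]: from [n ^ n <= 4 ^ (n - M) * M ^ n] and [3 * M <= N], the product
   [4 ^ (n - M) * N ^ n] is still at least [(3 * n) ^ n]. *)
have D := expn_le_exp4 (n - M) n ltac:(rewrite /N in EM *; lia).
have E : n - (n - M) = M by lia.
rewrite E in D.
have F : 4 ^ n = 4 ^ M * 4 ^ (n - M) by rewrite -expnD; congr (_ ^ _); lia.
rewrite F -mulnA leq_pmul2l ?expn_gt0 // in L.
rewrite -(leq_pmul2r n2p).
apply: (@leq_trans (4 ^ (n - M) * N ^ n)).
  apply: leq_trans (leq_mul (leqnn _) D) _.
  by rewrite mulnCA leq_mul2l -expnMn leq_exp2r //; apply/orP; right; lia.
by apply: leq_trans L _; rewrite -mul2n expnMn; apply/eq_leq; ring.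
Qed.

(** * Poles of the binomial sums *)

(** Otherwise the order of 2 modulo [p = pdiv m] divides both [m] and [p - 1], which are coprime by
    minimality of [p]; then [2 = 1] modulo [p]. *)
Lemma pdiv_exp2_pred (m : nat) : 1 < m -> ~~ (pdiv m %| 2 ^ m - 1).
Proof.
move=> m1; set p := pdiv m; apply/negP => pd.
have pp : prime p by exact: pdiv_prime.
have m2 : 2 ^ m = 1 %[mod p].
  by apply/eqP; rewrite eqn_mod_dvd ?expn_gt0.
have c2 : coprime 2 p.
  rewrite prime_coprime //; apply/negP => p2.
  have := dvdn_trans p2 pd; rewrite dvdn2 oddB ?expn_gt0 // oddX /=; lia.
have e2 : 2 ^ p.-1 = 1 %[mod p].
  by rewrite -(Euler_exp_totient c2) totient_prime.
have p10 : 0 < p.-1 by have := prime_gt1 pp; lia.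
have g1 : gcdn m p.-1 = 1.
  apply/eqP; rewrite eqn_leq gcdn_gt0 p10 orbT andbT leqNgt; apply/negP => g1.
  have := pdiv_min_dvd g1 (dvdn_gcdl _ _).
  have := dvdn_leq p10 (dvdn_gcdr m p.-1); rewrite -/p; lia.
have [u v E _] := egcdnP p.-1 (ltnW m1).
rewrite g1 in E.
have X k x : x = 1 %[mod p] -> x ^ k = 1 %[mod p].
  by move=> x1; rewrite -modnXm x1 modnXm exp1n.
have := X u _ m2; rewrite -expnM mulnC E expnD expn1 [v * _]mulnC expnM.
rewrite -modnMml X // modnMml mul1n => /eqP; rewrite eqn_mod_dvd // subn1 dvdn1.
by move/eqP => p1; rewrite p1 in pp.
Qed.

Local Open Scope ring_scope.

(** For prime [p], membership in the localization of the integers at [p], encoded by a multiplier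
    prime to [p] instead of a valuation. *)
Definition p_integral (p : nat) (x : rat) : Prop :=
  exists2 d : nat, ~~ (p %| d)%N & d%:R * x \is a Num.int.

Lemma p_integral_int p x : prime p -> x \is a Num.int -> p_integral p x.
Proof.
move=> pp xZ; exists 1%N; last by rewrite mul1r.
by rewrite dvdn1; apply: contraTneq pp => ->.
Qed.

Lemma p_integralB p x y : prime p ->
  p_integral p x -> p_integral p y -> p_integral p (x - y).
Proof.
move=> pp [d pd dx] [e pe ey]; exists (d * e)%N.
  by rewrite Euclid_dvdM // negb_or pd.
have -> : (d * e)%:R * (x - y) = e%:R * (d%:R * x) - d%:R * (e%:R * y) :> rat.
  by rewrite natrM; ring.
by rewrite rpredB // rpredM // natr_int.
Qed.

Lemma p_integral_sum p (I : Type) (s : seq I) (P : pred I) (F : I -> rat) : prime p ->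
  (forall i, P i -> p_integral p (F i)) -> p_integral p (\sum_(i <- s | P i) F i).
Proof.
move=> pp H; have p0 : p_integral p 0 by apply: p_integral_int; rewrite ?rpred0.
apply: big_ind => // x y Hx Hy; rewrite -[y]opprK -[- y]sub0r.
by apply: p_integralB => //; exact: p_integralB.
Qed.

Lemma p_integral_div p (a : int) b : ~~ (p %| b)%N -> p_integral p (a%:~R / b%:R).
Proof.
move=> pb; exists b => //; have b0 : b%:R != 0 :> rat.
  by rewrite pnatr_eq0; apply: contraNneq pb => ->; rewrite dvdn0.
by rewrite mulrC divfK // intr_int.
Qed.

Lemma p_integral_div_dvd p (a : int) b : prime p -> (0 < b)%N -> (p %| b)%N ->
  p_integral p (a%:~R / b%:R) -> (p %| `|a|)%N.
Proof.
move=> pp b0 pb [d pd /intrP[z E]].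
have b0' : b%:R != 0 :> rat by rewrite pnatr_eq0 -lt0n.
have {}E : d%:Z * a = z * b%:Z.
  apply: (@intr_inj rat); rewrite !intrM -E -[(b%:Z)%:~R]/(b%:R) -[(d%:Z)%:~R]/(d%:R).
  by rewrite -!mulrA mulVf // mulr1.
have : (p %| `|(d%:Z * a)%R|)%N by rewrite E abszM dvdn_mull.
by rewrite abszM Euclid_dvdM // (negPf pd).
Qed.

(** The term at [i0] is an integer minus [p]-integral terms, hence [p]-integral itself, so its
    numerator must absorb [p]. *)
Lemma unique_pole (p : nat) (s : seq nat) (i0 : nat) (a : nat -> int) (b : nat -> nat) :
  prime p -> uniq s -> i0 \in s -> (0 < b i0)%N -> (p %| b i0)%N ->
  (forall i, i \in s -> i != i0 -> ~~ (p %| b i)%N) ->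
  \sum_(i <- s) (a i)%:~R / (b i)%:R \is a @Num.int rat ->
  (p %| `|a i0|)%N.
Proof.
move=> pp us i0s b0 pb H; rewrite (bigD1_seq i0) //= => S.
apply: (@p_integral_div_dvd p _ (b i0)) => //.
rewrite -[_ / _](addrK (\sum_(i <- s | i != i0) (a i)%:~R / (b i)%:R)).
apply: p_integralB => //; first exact: p_integral_int.
rewrite big_seq_cond; apply: p_integral_sum => // i /andP[si ii0].
by apply: p_integral_div; exact: H.
Qed.

(* Integration by parts in [S(n, r) = r * \int_0^1 x ^ (r - 1) * (1 + x) ^ n dx]. *)
Lemma binom_sum_rec (n r : nat) : (0 < r)%N ->
  binom_sum n.+1 r = (2 ^ n.+1)%:R - n.+1%:R / r.+1%:R * binom_sum n r.+1.
Proof.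
move=> r0; rewrite /binom_sum.
have -> : (2 ^ n.+1)%:R = \sum_(0 <= k < n.+2) 'C(n.+1, k)%:R :> rat.
  rewrite -[2%N]/(1 + 1)%N expnDn natr_sum big_mkord; apply: eq_bigr => i _.
  by rewrite !exp1n !muln1.
have nz k : (k + r)%:R != 0 :> rat by rewrite pnatr_eq0; lia.
have nz' k : k.+1%:R != 0 :> rat by rewrite pnatr_eq0.
have E k : r%:R / (k + r)%:R * 'C(n.+1, k)%:R =
   'C(n.+1, k)%:R - (k * 'C(n.+1, k))%:R / (k + r)%:R :> rat.
  by have := nz k; rewrite natrM natrD => h; field.
under eq_bigr do rewrite E.
rewrite sumrB; congr (_ - _).
rewrite big_nat_recl //= mul0n mul0r add0r mulr_sumr.
apply: eq_bigr => k _.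
rewrite -mul_bin_diag /= natrM -addSnnS.
move: (nz k.+1) (nz' r); rewrite -mulrA.
move: (k.+1 + r)%:R r.+1%:R n.+1%:R 'C(n, k)%:R => x y z c x0 y0.
by field; rewrite x0 y0.
Qed.

(** Multiplying [binom_sum_rec] by the binomial coefficient gives an even integer minus the same
    product for [(n, r + 1)], so parity propagates down to [n = 0], where the product is 1. *)
Lemma bin_mul_binom_sum (n r : nat) : (0 < r)%N ->
  exists k : int, 'C(n + r, n)%:R * binom_sum n r = (2 * k + 1)%:~R.
Proof.
elim: n r => [|n IH] r r0.
  exists 0; rewrite /binom_sum big_nat1 !bin0 !mulr1 mul1r add0n divff //.
  by rewrite pnatr_eq0 -lt0n.
have [k Ek] := IH r.+1 isT.
exists ((2 ^ n)%N%:Z * 'C(n.+1 + r, n.+1)%:Z - k - 1).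
rewrite binom_sum_rec // mulrBr.
have -> : 'C(n.+1 + r, n.+1)%:R * (n.+1%:R / r.+1%:R * binom_sum n r.+1)
  = 'C(n + r.+1, n)%:R * binom_sum n r.+1.
  have r1 : r.+1%:R != 0 :> rat by rewrite pnatr_eq0.
  have : (n.+1 * 'C(n.+1 + r, n.+1))%:R = (r.+1 * 'C(n + r.+1, n))%:R :> rat.
    by rewrite addSnnS mul_bin_left; congr (_ * _)%:R; lia.
  rewrite !natrM => E; rewrite !mulrA; congr (_ * _).
  by rewrite [X in X / _]mulrC E mulrAC divff // mul1r.
rewrite Ek -natrM expnS.
have -> : ('C(n.+1 + r, n.+1) * (2 * 2 ^ n))%:R =
   (2 * ((2 ^ n)%N%:Z * 'C(n.+1 + r, n.+1)%:Z))%:~R :> rat.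
  by rewrite -PoszM -[2 : int]/(2%N%:Z) -PoszM -pmulrn; congr (_%:R); ring.
by rewrite -intrB; congr (_%:~R); ring.
Qed.

Lemma odd_bin_of_int (n r : nat) : (0 < r)%N ->
  binom_sum n r \is a Num.int -> odd 'C(n + r, n).
Proof.
move=> r0 /intrP[z Ez]; have [k] := bin_mul_binom_sum n r r0.
rewrite Ez pmulrn -intrM => /intr_inj E.
rewrite -[odd _]negbK; apply/negP => /even_halfK C2; move: E; rewrite -C2 -muln2 PoszM.
by move: ((_./2)%:Z) => c; lia.
Qed.

(** For [r >= 1], the integral of [x ^ (r - 1) * (1 + x) ^ n] over [[0, 1]]. *)
Definition recip_sum (n r : nat) : rat := \sum_(0 <= k < n.+1) 'C(n, k)%:R / (k + r)%:R.

(** Under the integral sign, this is [x = (1 + x) - 1]. *)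
Lemma recip_sumS (n r : nat) : recip_sum n r.+1 = recip_sum n.+1 r - recip_sum n r.
Proof.
apply/eqP; rewrite eq_sym subr_eq; apply/eqP.
rewrite /recip_sum [LHS]big_nat_recl //=.
rewrite (eq_bigr (fun k =>
  'C(n, k)%:R / (k + r.+1)%:R + 'C(n, k.+1)%:R / (k.+1 + r)%:R)); last first.
  by move=> k _; rewrite binS natrD mulrDl addrC addSnnS.
rewrite big_split /= addrCA; congr (_ + _).
rewrite [RHS]big_nat_recl //= !bin0; congr (_ + _).
by rewrite big_nat_recr //= bin_small // mul0r addr0.
Qed.

Lemma recip_sum1 (n : nat) : recip_sum n 1 = (2 ^ n.+1 - 1)%:R / n.+1%:R.
Proof.
have n1 k : k.+1%:R != 0 :> rat by rewrite pnatr_eq0.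
apply: (mulIf (n1 n)); rewrite divfK // /recip_sum mulr_suml.
rewrite (eq_bigr (fun k => 'C(n.+1, k.+1)%:R)); last first.
  move=> k _; rewrite addn1 mulrAC -natrM mulnC mul_bin_diag natrM mulrC mulKf //.
rewrite -natr_sum; congr (_%:R).
have -> : (2 ^ n.+1 = \sum_(0 <= k < n.+2) 'C(n.+1, k))%N.
  rewrite -[2%N]/(1 + 1)%N expnDn big_mkord; apply: eq_bigr => i _.
  by rewrite !exp1n !muln1.
by rewrite [in RHS]big_nat_recl //= bin0 addKn.
Qed.

(* Up to the factor [r], this is [S(n, r)] computed by expanding [(y - 1) ^ (r - 1)]
   in [\int_1^2 (y - 1) ^ (r - 1) * y ^ n dy]. *)
Lemma recip_sum_diff (n r : nat) : recip_sum n r.+1 =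
  \sum_(0 <= j < r.+1) (-1) ^+ (r + j) * 'C(r, j)%:R * ((2 ^ (n + j).+1 - 1)%:R / (n + j).+1%:R).
Proof.
elim: r n => [|r IH] n.
  by rewrite big_nat1 bin0 expr0 !mul1r addn0 recip_sum1.
rewrite recip_sumS !IH [RHS]big_nat_recl //=.
set f := fun m => (2 ^ m.+1 - 1)%:R / m.+1%:R : rat.
(* Pascal's rule splits each term into one of the expansion at [n.+1] and one of the expansion at
   [n]. *)
rewrite [in RHS](eq_bigr (fun j => (-1) ^+ (r + j) * 'C(r, j)%:R * f (n.+1 + j)%N
  - (-1) ^+ (r + j.+1) * 'C(r, j.+1)%:R * f (n + j.+1)%N)); last first.
  move=> j _; rewrite /f binS natrD addSnnS !addnS !addSn !exprS; ring.
rewrite sumrB addrCA; congr (_ + _).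
rewrite [in LHS]big_nat_recl // [in RHS]big_nat_recr //=.
rewrite (@bin_small r r.+1) // mulr0 mul0r addr0.
rewrite opprD -/(f _); congr (_ + _).
by rewrite /f !bin0 !addn0 exprS; ring.
Qed.

Lemma binom_sum_recip_sum (n r : nat) : binom_sum n r = r%:R * recip_sum n r.
Proof.
by rewrite /binom_sum /recip_sum mulr_sumr; apply: eq_bigr => k _; rewrite mulrAC mulrA.
Qed.

Lemma binom_sum_not_int_pdiv (n r j : nat) : (0 < n)%N -> (j < r)%N ->
  (r < pdiv (n + j).+1)%N -> binom_sum n r \isn't a Num.int.
Proof.
case: r => // r n0 jr; set p := pdiv _ => rp; apply/negP.
have m1 : (1 < (n + j).+1)%N by lia.
have pp : prime p by exact: pdiv_prime.
rewrite binom_sum_recip_sum recip_sum_diff mulr_sumr.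
pose a i : int := (-1) ^+ (r + i) * (r.+1 * 'C(r, i) * (2 ^ (n + i).+1 - 1))%N%:Z.
rewrite (eq_bigr (fun i => (a i)%:~R / (n + i).+1%:R)) => [|i _]; last first.
  rewrite /a intrM rmorphXn rmorphN1 /= -pmulrn !natrM; ring.
move/(@unique_pole p _ j a (fun i => (n + i).+1) pp (iota_uniq _ _ : uniq (index_iota 0 r.+1))).
rewrite mem_index_iota jr pdiv_dvd => /(_ isT isT isT) H.
have : (p %| `|a j|)%N.
  apply: H => i; rewrite mem_index_iota => /andP[_ ir] ij; apply/negP => pi.
  have pj : (p %| (n + j).+1)%N := pdiv_dvd _.
  case: (ltngtP i j) ij => // h _.
    have := dvdn_sub pj pi => /dvdn_leq; lia.
  have := dvdn_sub pi pj => /dvdn_leq; lia.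
(* The prime [p] exceeds [r.+1], so it divides neither [r.+1] nor ['C(r, j)], a divisor of [r!]. *)
rewrite /a abszM abszX exp1n mul1n absz_nat !Euclid_dvdM //.
rewrite (negPf (pdiv_exp2_pred _ m1)) orbF => /orP[/dvdn_leq|pC]; first lia.
have := dvdn_mulr (j`! * (r - j)`!) pC; rewrite bin_fact ?prime_dvd_fact //; lia.
Qed.

(** * The two ranges of the theorem *)

Lemma even_bin_odd (n r : nat) : odd n -> odd r -> ~~ odd 'C(n + r, n).
Proof.
case: n => // n on or.
have /(congr1 odd) := mul_bin_diag (n.+1 + r) n.
by rewrite !oddM on oddD on or /= => <-.
Qed.

(* Junk value 0 for [r > 6]. *)
Definition small_primorial (r : nat) : nat := nth 0%N [:: 1; 1; 2; 6; 6; 30; 30]%N r.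

(** Here [t] stands for [n] modulo 30, a multiple of every primorial involved; [t] and [r] both odd
    is the case settled by parity. *)
Lemma coprime_window_check :
  all (fun r => all (fun t => (odd t && odd r) ||
    has (fun j => coprime (t + j).+1 (small_primorial r)) (iota 0 r)) (iota 0 30)) (iota 1 6).
Proof. by vm_compute. Qed.

Lemma prime_dvd_small_primorial (p r : nat) :
  prime p -> (p <= r <= 6)%N -> (p %| small_primorial r)%N.
Proof.
move=> pp /andP[pr r6].
have /allP/(_ r) : all (fun r => all (fun p => prime p ==> (p %| small_primorial r)%N)
  (iota 0 r.+1)) (iota 0 7) by vm_compute.
rewrite mem_iota ltnS => /(_ r6)/allP/(_ p).
by rewrite mem_iota ltnS pr pp => /(_ isT).
Qed.

Lemma exists_large_pdiv (n r : nat) : (1 <= r <= 6)%N -> (0 < n)%N -> ~~ (odd n && odd r) ->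
  exists2 j, (j < r)%N & (r < pdiv (n + j).+1)%N.
Proof.
move=> r6 n0 onr; have /allP/(_ r) := coprime_window_check.
rewrite mem_iota => /(_ r6)/allP/(_ (n %% 30)%N).
have -> : odd (n %% 30)%N = odd n by lia.
rewrite mem_iota ltn_mod (negPf onr) => /(_ isT)/hasP[j].
rewrite mem_iota => /andP[_ jr] cj; exists j => //.
have {}cj : coprime (n + j).+1 (small_primorial r).
  have d30 : (small_primorial r %| 30)%N.
    by move: r6 {onr cj jr}; case: r => [|[|[|[|[|[|[|r]]]]]]].
  rewrite -coprime_modl; move: cj; rewrite -coprime_modl -!addnS.
  by rewrite -modnDml modn_dvdm // modnDml.
have m1 : (1 < (n + j).+1)%N by lia.
have pp := pdiv_prime m1; rewrite ltnNge; apply/negP => pr.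
have pD : (pdiv (n + j).+1 %| small_primorial r)%N.
  by apply: prime_dvd_small_primorial => //; lia.
have := coprime_dvdl (pdiv_dvd _) cj; rewrite prime_coprime // pD.
by [].
Qed.

Lemma binom_sum_not_int_small (n r : nat) :
  (1 <= r <= 6)%N -> (2 <= n)%N -> binom_sum n r \isn't a Num.int.
Proof.
move=> r6 n2; apply/negP => S.
have [r0 _] := andP r6; have oC := odd_bin_of_int n r r0 S.
have onr : ~~ (odd n && odd r).
  by apply/negP => /andP[on or]; rewrite (negPf (even_bin_odd n r on or)) in oC.
have [j jr rp] := exists_large_pdiv n r r6 (ltnW n2) onr.
by have := binom_sum_not_int_pdiv n r j (ltnW n2) jr rp; rewrite S.
Qed.

Lemma binom_sum_not_int_large (n r : nat) :
  (1 <= n <= r - 1)%N -> binom_sum n r \isn't a Num.int.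
Proof.
move=> nr; apply/negP => S; have r0 : (0 < r)%N by lia.
have [|p [pp np pC]] := sylvester_odd_bin n r _ (odd_bin_of_int n r r0 S); first lia.
(* As [p] divides [(n + r) ^_ n], it divides a factor [n + r - i] with [i < n], which is [k + r] for
   [k = n - i]. *)
have [k kn pk] : exists2 k, (0 < k <= n)%N & (p %| k + r)%N.
  have := dvdn_mulr n`! pC; rewrite bin_ffact ffact_prod Euclid_dvd_prod //.
  rewrite big_has => /hasP[i _ pi]; exists (n - i)%N; first by have := ltn_ord i; lia.
  have -> : (n - i + r = n + r - i)%N by have := ltn_ord i; lia.
  by [].
move: S; rewrite /binom_sum.
pose a i : int := (r * 'C(n, i))%N%:Z.
rewrite (eq_bigr (fun i => (a i)%:~R / (i + r)%:R)) => [|i _]; last first.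
  by rewrite /a -pmulrn natrM mulrAC.
move/(@unique_pole p _ k a (fun i => i + r)%N pp (iota_uniq _ _ : uniq (index_iota 0 n.+1))).
rewrite mem_index_iota pk addn_gt0 r0 orbT => /(_ _ isT isT) H.
have : (p %| `|a k|)%N.
  apply: H => [|i]; first lia.
  rewrite mem_index_iota => /andP[_ i_n] ik; apply/negP => pi.
  case: (ltngtP i k) ik => // h _.
    have := dvdn_sub pk pi => /dvdn_leq; lia.
  have := dvdn_sub pi pk => /dvdn_leq; lia.
(* If [p] divided [r] it would divide [k], and if it divided ['C(n, k)] it would divide [n!]; both
   contradict [p > n]. *)
rewrite /a absz_nat Euclid_dvdM // => /orP[pr|pCk].
  by move: pk; rewrite dvdn_addl // => /dvdn_leq; lia.
have := dvdn_mulr (k`! * (n - k)`!) pCk; rewrite bin_fact ?prime_dvd_fact //; lia.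
Qed.

Theorem theorem2 :
  (forall n r : nat, (1 <= r <= 6)%N -> (2 <= n)%N -> binom_sum n r \isn't a Num.int) /\
  (forall n r : nat, (1 <= n <= r - 1)%N -> binom_sum n r \isn't a Num.int).
Proof. by split; [exact: binom_sum_not_int_small | exact: binom_sum_not_int_large]. Qed.
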